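(* Let $\mathcal{I}\in\{\mathcal{B},\mathcal{P}_\infty,\mathcal{P}\}$ and let $\mathcal{F}\subseteq\mathcal{I}$ be such that $\{\nu\in\mathcal{I}: X_\nu\equiv X_\mu\}\subseteq\mathcal{F}$ for every $\mu\in\mathcal{F}$. Then \[\{\nu\in\mathcal{I}: X_\nu\text{ is finitely representable in }\mathcal{F}\}=\overline{\mathcal{F}}\cap\mathcal{I}.\] In particular, if $X$ is a separable infinite-dimensional Banach space, then for each $\mathcal{I}\in\{\mathcal{B},\mathcal{P}_\infty,\mathcal{P}\}$ \[\{\nu\in\mathcal{I}: X_\nu\text{ is finitely representable in }X\}=\overline{\{\mu\in\mathcal{I}: X_\mu\equiv X\}}\cap\mathcal{I}.\]
   Context: Banach spaces are real; $\equiv$ denotes linear isometry of Banach spaces; closures are taken in $\mathcal{P}$. $V$ is the $\mathbb{Q}$-vector space of finitely supported sequences of rational numbers with canonical basis $(e_n)_{n\in\mathbb{N}}$, and $c_{00}\supseteq V$ is the real vector space of finitely supported real sequences. $\mathcal{P}$ is the set of all pseudonorms (seminorms) on $V$, with the topology inherited from $\mathbb{R}^V$ (pointwise convergence). Each $\mu\in\mathcal{P}$ is identified with its extension to a pseudonorm on $c_{00}$. $X_\mu$ is the Banach space obtained as the completion of the quotient of $(c_{00},\mu)$ by $\{x\in c_{00}:\mu(x)=0\}$. $\mathcal{P}_\infty$ is the set of $\mu\in\mathcal{P}$ with $X_\mu$ infinite-dimensional, and $\mathcal{B}$ is the set of those $\mu\in\mathcal{P}_\infty$ whose extension to $c_{00}$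 is a norm. For $K\ge 1$, a $K$-isomorphism is a linear map $T$ with $K^{-1}\|x\|\le\|Tx\|\le K\|x\|$ for all $x$. A Banach space $X$ is finitely representable in a family $\mathcal{G}$ of Banach spaces if for every finite-dimensional subspace $E$ of $X$ and every $\varepsilon>0$ there is a finite-dimensional subspace $F$ of some $Y\in\mathcal{G}$ which is $(1+\varepsilon)$-isomorphic to $E$ (i.e. there is a surjective $(1+\varepsilon)$-isomorphism $E\to F$). Finitely representable in a Banach space $Y$ means in $\{Y\}$; finitely representable in $\mathcal{F}\subseteq\mathcal{P}$ means in $\{X_\mu:\mu\in\mathcal{F}\}$. *)

(* Defs.v *)
From HB Require Import structures.
From mathcomp Require Import all_boot all_order all_algebra.
From mathcomp Require Import generic_quotient interval_inference.
From mathcomp Require Import all_classical all_reals topology normedtype sequences.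

Set Implicit Arguments.
Unset Strict Implicit.
Unset Printing Implicit Defensive.

Import Order.TTheory GRing.Theory Num.Theory.
Import numFieldNormedType.Exports.

Local Open Scope classical_set_scope.
Local Open Scope ring_scope.
Local Open Scope quotient_scope.

(* Real-valued pseudonorms on a vector space over a field K embedded in R by
   [i]; nonnegativity follows from the two clauses ([pseudonorm_ge0]). *)
Definition pseudonorm_for (R : realType) (K : fieldType) (i : K -> R)
    (E : lmodType K) (p : E -> R) : Prop :=
  (forall x y, p (x + y) <= p x + p y) /\
  (forall a x, p (a *: x) = `|i a| * p x).

Section PseudonormTheory.
Variables (R : realType) (K : fieldType) (i : {rmorphism K -> R}).
Variables (E : lmodType K) (p : E -> R) (hp : pseudonorm_for i p).

Lemma pseudonorm0 : p 0 = 0.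
Proof. by rewrite -(scale0r (0 : E)) hp.2 rmorph0 normr0 mul0r. Qed.

Lemma pseudonormN x : p (- x) = p x.
Proof. by rewrite -scaleN1r hp.2 rmorphN1 normrN1 mul1r. Qed.

Lemma pseudonorm_ge0 x : 0 <= p x.
Proof.
have := hp.1 x (- x); rewrite subrr pseudonorm0 pseudonormN -mulr2n.
by rewrite pmulrn_lge0.
Qed.

Lemma pseudonormB x y : p (x - y) = p (y - x).
Proof. by rewrite -pseudonormN opprB. Qed.

Lemma pseudonorm_dist x y : `|p x - p y| <= p (x - y).
Proof.
rewrite ler_norml lerBlDr -{3}(subrK y x) hp.1 andbT.
by rewrite lerNl opprB lerBlDr pseudonormB -{1}(subrK x y) hp.1.
Qed.

End PseudonormTheory.

Section SeminormQuotient.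
Variables (R : realType) (E : lmodType R) (p : E -> R).
Hypothesis hp : pseudonorm_for idfun p.

Let hp' : pseudonorm_for (idfun : {rmorphism R -> R}) p := hp.

Definition pn_eqv (_ : pseudonorm_for idfun p) : rel E :=
  fun x y => p (x - y) == 0.

Lemma pn_eqv_equiv : equiv_class_of (pn_eqv hp).
Proof.
split=> [x|x y|y x z] /=; rewrite /pn_eqv.
- by rewrite subrr (pseudonorm0 hp').
- by rewrite (pseudonormB hp').
- move=> /eqP xy /eqP yz; rewrite eq_le (pseudonorm_ge0 hp') andbT.
  have := hp.1 (x - y) (y - z); rewrite xy yz addr0.
  by rewrite addrA subrK.
Qed.

Canonical pn_eqv_equivRel := EquivRelPack pn_eqv_equiv.
Canonical pn_eqv_encModRel := defaultEncModRel (pn_eqv hp).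

(* The quotient of (E, p) by the kernel of p, normed by p. *)
Definition pn_quot := {eq_quot (pn_eqv hp)}.
HB.instance Definition _ := Choice.on pn_quot.
HB.instance Definition _ := EqQuotient.on pn_quot.

Let pi_eqP (x y : E) : p (x - y) = 0 -> \pi_pn_quot x = \pi_pn_quot y.
Proof. by move=> xy; apply/eqmodP; rewrite /= /pn_eqv xy. Qed.

Lemma pn_repr (x : E) : p (repr (\pi_pn_quot x) - x) = 0.
Proof.
have /eqmodP : \pi_pn_quot (repr (\pi_pn_quot x)) = \pi_pn_quot x by rewrite reprK.
by move=> /eqP.
Qed.

Lemma pn_repr_eq (x : E) : p (repr (\pi_pn_quot x)) = p x.
Proof.
have := pseudonorm_dist hp' (repr (\pi_pn_quot x)) x.
by rewrite pn_repr normr_le0 subr_eq0 => /eqP.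
Qed.

Definition pnq_add (q r : pn_quot) := \pi_pn_quot (repr q + repr r).
Definition pnq_opp (q : pn_quot) := \pi_pn_quot (- repr q).
Definition pnq_scale (a : R) (q : pn_quot) := \pi_pn_quot (a *: repr q).
Definition pnq_norm (q : pn_quot) := p (repr q).

Let p0_le (x y : E) : p x = 0 -> p y = 0 -> p (x + y) = 0.
Proof.
move=> x0 y0; apply/eqP; rewrite eq_le (pseudonorm_ge0 hp') andbT.
by have := hp.1 x y; rewrite x0 y0 addr0.
Qed.

Lemma pnq_addE x y : pnq_add (\pi x) (\pi y) = \pi_pn_quot (x + y).
Proof.
apply: pi_eqP; rewrite opprD addrACA; apply: p0_le; exact: pn_repr.
Qed.

Lemma pnq_oppE x : pnq_opp (\pi x) = \pi_pn_quot (- x).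
Proof.
by apply: pi_eqP; rewrite -opprD (pseudonormN hp') pn_repr.
Qed.

Lemma pnq_scaleE a x : pnq_scale a (\pi x) = \pi_pn_quot (a *: x).
Proof. by apply: pi_eqP; rewrite -scalerBr hp.2 pn_repr mulr0. Qed.

Lemma pnq_addA : associative pnq_add.
Proof. by elim/quotW=> x; elim/quotW=> y; elim/quotW=> z; rewrite !pnq_addE addrA. Qed.
Lemma pnq_addC : commutative pnq_add.
Proof. by elim/quotW=> x; elim/quotW=> y; rewrite !pnq_addE addrC. Qed.
Lemma pnq_add0 : left_id (\pi_pn_quot 0) pnq_add.
Proof. by elim/quotW=> x; rewrite !pnq_addE add0r. Qed.
Lemma pnq_addN : left_inverse (\pi_pn_quot 0) pnq_opp pnq_add.
Proof. by elim/quotW=> x; rewrite pnq_oppE !pnq_addE addNr. Qed.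

HB.instance Definition _ :=
  GRing.isZmodule.Build pn_quot pnq_addA pnq_addC pnq_add0 pnq_addN.

Lemma pnq_scaleA a b (q : pn_quot) :
  pnq_scale a (pnq_scale b q) = pnq_scale (a * b) q.
Proof. by elim/quotW: q => x; rewrite !pnq_scaleE scalerA. Qed.
Lemma pnq_scale1 : left_id 1 pnq_scale.
Proof. by elim/quotW=> x; rewrite !pnq_scaleE scale1r. Qed.
Lemma pnq_scaleDr : right_distributive pnq_scale +%R.
Proof.
move=> a; elim/quotW=> x; elim/quotW=> y; rewrite /GRing.add /=.
by rewrite !(pnq_addE, pnq_scaleE) scalerDr.
Qed.
Lemma pnq_scaleDl (q : pn_quot) : {morph pnq_scale^~ q : a b / a + b}.
Proof.
move=> a b; elim/quotW: q => x; rewrite {2}/GRing.add /=.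
by rewrite !(pnq_addE, pnq_scaleE) scalerDl.
Qed.

HB.instance Definition _ := GRing.Zmodule_isLmodule.Build R pn_quot
  pnq_scaleA pnq_scale1 pnq_scaleDr pnq_scaleDl.

Lemma pnq_normD (x y : pn_quot) : pnq_norm (x + y) <= pnq_norm x + pnq_norm y.
Proof. by rewrite {1}/pnq_norm pn_repr_eq hp.1. Qed.
Lemma pnq_normZ a (x : pn_quot) : pnq_norm (a *: x) = `|a| * pnq_norm x.
Proof. by rewrite {1}/pnq_norm pn_repr_eq hp.2. Qed.
Lemma pnq_norm0_eq0 (x : pn_quot) : pnq_norm x = 0 -> x = 0.
Proof.
rewrite /pnq_norm => x0; rewrite -[x]reprK; apply: pi_eqP.
by rewrite subr0.
Qed.

HB.instance Definition _ := Lmodule_isNormed.Build R pn_quot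
  pnq_normD pnq_normZ pnq_norm0_eq0.

Lemma pn_pi_linear : linear (\pi_pn_quot).
Proof.
by move=> a x y; rewrite -pnq_addE -pnq_scaleE.
Qed.
HB.instance Definition _ := GRing.isLinear.Build R E pn_quot _ \pi_pn_quot pn_pi_linear.

Lemma norm_pn_pi x : `|\pi_pn_quot x : pn_quot| = p x.
Proof. exact: pn_repr_eq. Qed.

End SeminormQuotient.

Section Completion.
Variables (R : realType) (E : normedModType R).

Definition is_cauchy_seq (u : nat -> E) : bool := `[< cauchy (u @ \oo) >].

Lemma is_cauchy_seqP (u : nat -> E) : reflect
  (forall e : R, 0 < e ->
     exists N, forall m n, (N <= m)%N -> (N <= n)%N -> `|u m - u n| < e)
  (is_cauchy_seq u).
Proof.
apply: (iffP (asboolP _)).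
  move=> /cauchy_ballP hu e e0; have := hu _ e0.
  move=> [[A B]] /= [[N1 _ AN] [N2 _ BN]] AB.
  exists (maxn N1 N2) => m n; rewrite !geq_max => /andP[m1 m2] /andP[n1 n2].
  have := AB (u m, u n); rewrite -ball_normE /=; apply; split => /=.
    exact: AN.
  exact: BN.
move=> hu; apply/cauchy_ballP => e e0; have [N hN] := hu _ e0.
exists ([set x | exists2 n, (N <= n)%N & x = u n],
        [set x | exists2 n, (N <= n)%N & x = u n]) => /=.
  by split; exists N => // n /= Nn; exists n.
by move=> [x y] /= [[m Nm ->] [n Nn ->]]; rewrite -ball_normE /=; exact: hN.
Qed.

Lemma cauchy_submod : submod_closed is_cauchy_seq.
Proof.
split.
  by apply/is_cauchy_seqP => e e0; exists 0%N => m n _ _; rewrite subrr normr0.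
move=> a u v /is_cauchy_seqP hu /is_cauchy_seqP hv.
apply/is_cauchy_seqP => e e0.
have e1 : 0 < e / 2 / (`|a| + 1) by rewrite !divr_gt0 // ltr_wpDl.
have [N1 h1] := hu _ e1; have [N2 h2] := hv _ (divr_gt0 e0 (ltr0n _ 2)).
exists (maxn N1 N2) => m n; rewrite !geq_max => /andP[m1 m2] /andP[n1 n2].
rewrite [X in `|X|](_ : _ = a *: (u m - u n) + (v m - v n)); last first.
  by rewrite scalerBr opprD addrACA.
rewrite (le_lt_trans (ler_normD _ _)) // [ltRHS]splitr.
apply: ler_ltD; last exact: h2.
rewrite normrZ (@le_trans _ _ ((`|a| + 1) * `|u m - u n|)) //.
  by rewrite ler_wpM2r // lerDl.
by rewrite mulrC -ler_pdivlMr ?ltr_wpDl // ltW // h1.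
Qed.

HB.instance Definition _ :=
  GRing.isSubmodClosed.Build R (nat -> E) is_cauchy_seq cauchy_submod.

Definition cauchy_seq := {u : nat -> E | is_cauchy_seq u}.
Definition CauchySeq u (hu : is_cauchy_seq u) : cauchy_seq :=
  exist (fun v => is_true (is_cauchy_seq v)) u hu.
HB.instance Definition _ := Choice.on cauchy_seq.
HB.instance Definition _ := SubChoice.on cauchy_seq.
HB.instance Definition _ :=
  [SubChoice_isSubLmodule of cauchy_seq by <:].

Lemma cauchy_norm_cvg (u : cauchy_seq) : cvg (`|val u n| @[n --> \oo]).
Proof.
apply: cauchy_cvg; apply/cauchy_ballP => e e0.
have /is_cauchy_seqP/(_ _ e0)[N hN] := valP u.
exists ([set x | exists2 n, (N <= n)%N & x = `|val u n|],
        [set x | exists2 n, (N <= n)%N & x = `|val u n|]) => /=.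
  by split; exists N => // n /= Nn; exists n.
move=> [x y] /= [[m Nm ->] [n Nn ->]]; rewrite -ball_normE /=.
by rewrite (le_lt_trans (ler_dist_dist _ _)) // hN.
Qed.

Definition cauchy_pn (u : cauchy_seq) : R := lim (`|val u n| @[n --> \oo]).

Lemma cauchy_pnP : pseudonorm_for idfun cauchy_pn.
Proof.
split=> [u v|a u]; rewrite /cauchy_pn.
  rewrite -limD; try exact: cauchy_norm_cvg.
  apply: ler_lim; first exact: cauchy_norm_cvg.
    by apply: is_cvgD; exact: cauchy_norm_cvg.
  by apply: nearW => n; rewrite raddfD /= ler_normD.
apply/cvg_lim => //=.
rewrite [X in X @ _](_ : _ = fun n => `|a| * `|val u n|); last first.
  by apply/funext => n; rewrite -normrZ.
by apply: cvgMr; exact: cauchy_norm_cvg.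
Qed.

(* The completion of E: Cauchy sequences of E modulo the kernel of the pseudonorm
   u |-> lim |u_n|, i.e. modulo null sequences. *)
Definition completion := pn_quot cauchy_pnP.
HB.instance Definition _ := NormedModule.on completion.
HB.instance Definition _ := EqQuotient.on completion.

Lemma cauchy_cst (x : E) : is_cauchy_seq (fun=> x).
Proof.
by apply/is_cauchy_seqP => e e0; exists 0%N => m n _ _; rewrite subrr normr0.
Qed.

Definition completion_in (x : E) : completion :=
  \pi_completion (CauchySeq (cauchy_cst x)).

Lemma completion_in_linear : linear completion_in.
Proof.
move=> a x y; rewrite /completion_in -linearP; congr (\pi _).
exact: val_inj.
Qed.
HB.instance Definition _ :=
  GRing.isLinear.Build R E completion _ completion_in completion_in_linear.

Lemma norm_completion_in x : `|completion_in x| = `|x|.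
Proof. by rewrite [LHS]norm_pn_pi /cauchy_pn /= lim_cst. Qed.

Lemma completion_in_near (u : cauchy_seq) (e : R) (N : nat) :
    (forall m n, (N <= m)%N -> (N <= n)%N -> `|val u m - val u n| < e) ->
  forall m, (N <= m)%N -> `|\pi_completion u - completion_in (val u m)| <= e.
Proof.
move=> hN m Nm; rewrite /completion_in -linearB [leLHS]norm_pn_pi /cauchy_pn.
apply: limr_le; first exact: cauchy_norm_cvg.
by exists N => // n /= Nn; rewrite ltW // hN.
Qed.

Lemma dense_completion_in : dense (range completion_in).
Proof.
move=> U [x Ux] oU; have := open_nbhs_nbhs (conj oU Ux).
rewrite -nbhs_ballE => -[e /= e0]; rewrite -ball_normE /= => eU.
move: x Ux eU; elim/quotW => u Ux eU.
have /is_cauchy_seqP/(_ _ (divr_gt0 e0 (ltr0n R 2)))[N hN] := valP u.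
exists (completion_in (val u N)); split; last by exists (val u N).
apply: eU; rewrite /= (le_lt_trans (completion_in_near hN (leqnn N))) //.
by rewrite gtr_pMr // invf_lt1 ?ltr1n.
Qed.

Lemma completion_complete (F : set_system completion) :
  ProperFilter F -> cauchy F -> cvg F.
Proof.
move=> FF /cauchyP Fc.
have n0 n : 0 < n.+1%:R^-1 :> R by rewrite invr_gt0.
have /choice[x hx] : forall n, exists x : completion, F (ball x n.+1%:R^-1).
  by move=> n; exact: Fc.
have /choice[w hw] : forall n, exists w : E,
    `|x n - completion_in w| < n.+1%:R^-1.
  move=> n; have [] := @dense_completion_in (ball (x n) n.+1%:R^-1).
  - by exists (x n); exact: ballxx.
  - exact: ball_open.
  - by move=> y [xy [w _ wy]]; exists w; move: xy; rewrite wy -ball_normE.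
have inv_lt (e : R) : 0 < e -> exists N, forall n, (N <= n)%N -> n.+1%:R^-1 < e.
  move=> /posnumP[{}e]; have [N _ hN] := near_infty_natSinv_lt e.
  by exists N => n Nn; exact: (hN n).
have xw_ n y : ball (x n) n.+1%:R^-1 y ->
    `|completion_in (w n) - y| < n.+1%:R^-1 + n.+1%:R^-1.
  rewrite -ball_normE /= => hy; rewrite -(subrKA (x n)).
  by rewrite (le_lt_trans (ler_normD _ _)) // ltrD // distrC.
have wc : is_cauchy_seq w.
  apply/is_cauchy_seqP => e e0.
  have [N hN] := inv_lt _ (divr_gt0 e0 (ltr0n R 4)).
  exists N => m n Nm Nn.
  have [y [/xw_ ym /xw_ yn]] := filter_ex (filterI (hx m) (hx n)).
  rewrite -norm_completion_in linearB -(subrKA y).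
  rewrite (le_lt_trans (ler_normD _ _)) // -[X in _ + X]normrN opprB.
  apply: (lt_trans (ltrD ym yn)).
  rewrite (_ : e = (e / 4 + e / 4) + (e / 4 + e / 4)); last first.
    by rewrite -!mulrDl -!mulr2n -mulrnA -[X in X / _]mulr_natr mulfK.
  by rewrite !ltrD // hN.
pose u : cauchy_seq := CauchySeq wc.
apply/cvg_ex; exists (\pi_completion u); apply/cvgrPdist_lt => /= e e0.
have [N1 hN1] := inv_lt _ (divr_gt0 e0 (ltr0n R 4)).
have /is_cauchy_seqP/(_ _ (divr_gt0 e0 (ltr0n R 2)))[N2 hN2] := valP u.
pose N := maxn N1 N2.
have NN1 : (N1 <= N)%N := leq_maxl _ _.
have NN2 : (N2 <= N)%N := leq_maxr _ _.
near=> y.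
rewrite -(subrKA (completion_in (w N))) (le_lt_trans (ler_normD _ _)) //.
rewrite [ltRHS]splitr; apply: ler_ltD.
  exact: (completion_in_near hN2).
apply: (lt_trans (xw_ _ y _)); first by near: y; exact: hx.
rewrite (_ : e / 2 = e / 4 + e / 4); first by rewrite ltrD // hN1.
by rewrite [LHS]splitr -mulrA -invfM -natrM.
Unshelve. all: by end_near. Qed.

HB.instance Definition _ := Uniform_isComplete.Build completion completion_complete.

End Completion.

(* {poly K} serves as the K-vector space of finitely supported K-valued
   sequences, e_n being 'X^n: V is {poly rat} and c_00 is {poly R}. *)
Section Extension.
Variable R : realType.

Definition V_in_c00 (v : {poly rat}) : {poly R} := map_poly ratr v.

Lemma pseudonorm_le_l1 (K : fieldType) (i : {rmorphism K -> R})
    (p : {poly K} -> R) (y : {poly K}) : pseudonorm_for i p ->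
  p y <= \sum_(k < size y) `|i y`_k| * p 'X^k.
Proof.
move=> hp; rewrite -{1}[y]coefK poly_def.
elim/big_ind2 : _ => [|x1 x2 y1 y2 h1 h2|k _]; first by rewrite (pseudonorm0 hp).
  by rewrite (le_trans (hp.1 _ _)) // lerD.
by rewrite hp.2.
Qed.

Lemma V_dense (p : {poly R} -> R) (x : {poly R}) (e : R) :
  pseudonorm_for idfun p -> 0 < e -> exists v, p (x - V_in_c00 v) < e.
Proof.
move=> hp; have hp' : pseudonorm_for (idfun : {rmorphism R -> R}) p := hp.
rewrite -[x]coefK poly_def; move: e.
elim/big_ind : _ => [|y z hy hz|k _] e e0.
- by exists 0; rewrite /V_in_c00 rmorph0 subr0 (pseudonorm0 hp').
- have e2 := divr_gt0 e0 (ltr0n R 2).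
  have [v hv] := hy _ e2; have [w hw] := hz _ e2; exists (v + w).
  rewrite /V_in_c00 rmorphD /= opprD addrACA (le_lt_trans (hp.1 _ _)) //.
  by rewrite [ltRHS]splitr ltrD.
- have d0 : 0 < e / (p 'X^k + 1).
    by rewrite divr_gt0 // ltr_wpDl // (pseudonorm_ge0 hp').
  have [|q] := @rat_in_itvoo R (x`_k - e / (p 'X^k + 1)) (x`_k).
    by rewrite ltrBlDr ltrDl.
  rewrite in_itv /= => /andP[h1 h2]; exists (q *: 'X^k).
  rewrite /V_in_c00 map_polyZ /= map_polyXn -scalerBl hp.2 /=.
  rewrite ger0_norm; last by rewrite subr_ge0 ltW.
  have : x`_k - ratr q < e / (p 'X^k + 1) by rewrite ltrBlDr -ltrBlDl.
  rewrite ltr_pdivlMr; last by rewrite ltr_wpDl // (pseudonorm_ge0 hp').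
  by apply: le_lt_trans; rewrite mulrDr lerDl mulr1 subr_ge0 ltW.
Qed.

Lemma c00_ext_unique (p q : {poly R} -> R) :
  pseudonorm_for idfun p -> pseudonorm_for idfun q ->
  (forall v, p (V_in_c00 v) = q (V_in_c00 v)) -> p = q.
Proof.
move=> hp hq pq; apply/funext => x; apply/eqP; rewrite -subr_eq0 -normr_le0.
have hp' : pseudonorm_for (idfun : {rmorphism R -> R}) p := hp.
have hq' : pseudonorm_for (idfun : {rmorphism R -> R}) q := hq.
have hs : pseudonorm_for idfun (fun y => p y + q y).
  by split=> [y z|a y]; rewrite ?hp.2 ?hq.2 ?mulrDr // addrACA lerD ?hp.1 ?hq.1.
apply/ler_addgt0Pr => e e0; rewrite add0r.
have [v /ltW hv] := V_dense x hs e0; apply: le_trans hv.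
rewrite -(subrKA (p (V_in_c00 v))) (le_trans (ler_normD _ _)) // lerD //.
  exact: pseudonorm_dist hp' _ _.
by rewrite pq (pseudonormB hq'); exact: pseudonorm_dist hq' _ _.
Qed.

Section Existence.
Variables (mu : {poly rat} -> R) (hmu : pseudonorm_for ratr mu).

Let hmu' : pseudonorm_for (ratr : {rmorphism rat -> R}) mu := hmu.

Let A (y : {poly R}) : R := \sum_(k < size y) `|y`_k| * mu 'X^k.

Let AE n (y : {poly R}) : (size y <= n)%N -> A y = \sum_(k < n) `|y`_k| * mu 'X^k.
Proof.
move=> yn; rewrite /A (big_ord_widen _ (fun k => `|y`_k| * mu 'X^k) yn).
rewrite big_mkcond; apply: eq_bigr => k _; case: ltnP => // yk.
by rewrite nth_default // normr0 mul0r.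
Qed.

Let A_pn : pseudonorm_for idfun A.
Proof.
split=> [x y|a x].
  rewrite (AE (size_polyD x y)) (AE (leq_maxl _ (size y))) (AE (leq_maxr (size x) _)).
  rewrite -big_split /=; apply: ler_sum => k _; rewrite coefD -mulrDl.
  by rewrite ler_wpM2r ?ler_normD // (pseudonorm_ge0 hmu').
rewrite (AE (size_scale_leq a x)) mulr_sumr; apply: eq_bigr => k _.
by rewrite coefZ normrM mulrA.
Qed.

Let A_pn' : pseudonorm_for (idfun : {rmorphism R -> R}) A := A_pn.

Let mu_le_A v : mu v <= A (V_in_c00 v).
Proof.
rewrite (le_trans (pseudonorm_le_l1 _ hmu')) // (AE (size_poly _ _)) le_eqVlt.
by apply/orP; left; apply/eqP/eq_bigr => k _; rewrite coef_map.
Qed.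

Let S (x : {poly R}) := range (fun v => mu v + A (x - V_in_c00 v)).
Let N (x : {poly R}) := inf (S x).

Let S0 x : S x !=set0.
Proof. by exists (mu 0 + A (x - V_in_c00 0)); exists 0. Qed.

Let N_le x v : N x <= mu v + A (x - V_in_c00 v).
Proof.
apply: ge_inf; last by exists v.
exists 0 => _ [w _ <-].
by rewrite addr_ge0 ?(pseudonorm_ge0 hmu') ?(pseudonorm_ge0 A_pn').
Qed.

Let le_N x c : (forall v, c <= mu v + A (x - V_in_c00 v)) -> c <= N x.
Proof. by move=> h; apply: lb_le_inf => // _ [v _ <-]. Qed.

Let NA x : N x <= A x.
Proof.
by have := N_le x 0; rewrite /V_in_c00 rmorph0 subr0 (pseudonorm0 hmu') add0r.
Qed.

Let N_ge0 x : 0 <= N x.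
Proof.
by apply: le_N => w; rewrite addr_ge0 ?(pseudonorm_ge0 hmu') ?(pseudonorm_ge0 A_pn').
Qed.

Let ND (x y : {poly R}) : N (x + y) <= N x + N y.
Proof.
rewrite -lerBlDr; apply: le_N => v; rewrite lerBlDr [leRHS]addrC -lerBlDr.
apply: le_N => w; rewrite lerBlDr (le_trans (N_le _ (w + v))) //.
rewrite /V_in_c00 rmorphD /= addrACA lerD ?hmu.1 //.
by rewrite [x + y]addrC opprD addrACA A_pn.1.
Qed.

Let NQ (q : rat) x : N (ratr q *: x) <= `|ratr q| * N x.
Proof.
have [->|q0] := eqVneq q 0.
  rewrite rmorph0 scale0r normr0 mul0r (le_trans (NA _)) //.
  by rewrite (pseudonorm0 A_pn').
have q1 : 0 < `|ratr q : R| by rewrite normr_gt0 fmorph_eq0.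
rewrite -ler_pdivrMl //; apply: le_N => v; rewrite ler_pdivrMl //.
rewrite (le_trans (N_le _ (q *: v))) // hmu.2 mulrDr lerD2l.
by rewrite /V_in_c00 map_polyZ /= -scalerBr A_pn.2.
Qed.

Let NZ_le (a : R) x : N (a *: x) <= `|a| * N x.
Proof.
apply/ler_addgt0Pr => e e0.
have c0 : 0 < N x + A x + 1.
  by rewrite ltr_wpDl // addr_ge0 // (pseudonorm_ge0 A_pn').
have [|q] := @rat_in_itvoo R (a - e / (N x + A x + 1)) a.
  by rewrite ltrBlDr ltrDl divr_gt0.
rewrite in_itv /= => /andP[h1 h2].
have aq : `|a - ratr q| < e / (N x + A x + 1).
  by rewrite gtr0_norm ?subr_gt0 // ltrBlDr -ltrBlDl.
rewrite -[in leLHS](subrK (ratr q) a) scalerDl (le_trans (ND _ _)) //.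
rewrite [leLHS]addrC; have := NQ q x => /lerD/(_ (NA _))/le_trans; apply.
have : `|ratr q : R| <= `|a| + `|a - ratr q|.
  by rewrite distrC -{1}(subrK a (ratr q)) addrC ler_normD.
move=> /(ler_wpM2r (N_ge0 x))/lerD/(_ (lexx (A ((a - ratr q) *: x)))).
move=> /le_trans; apply; rewrite A_pn.2 mulrDl -addrA lerD2l -mulrDr.
move: aq; rewrite ltr_pdivlMr // => /ltW; apply: le_trans.
by rewrite ler_wpM2l // lerDl.
Qed.

Let N_pn : pseudonorm_for idfun N.
Proof.
split=> // a x; apply/eqP; rewrite eq_le NZ_le /=.
have [->|a0] := eqVneq a 0; first by rewrite normr0 mul0r.
by rewrite -ler_pdivlMl ?normr_gt0 // -normfV -{1}[x](scalerK a0) NZ_le.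
Qed.

Let N_V v : N (V_in_c00 v) = mu v.
Proof.
apply/eqP; rewrite eq_le; apply/andP; split.
  by have := N_le (V_in_c00 v) v; rewrite subrr (pseudonorm0 A_pn') addr0.
apply: le_N => w; have := hmu.1 (v - w) w; rewrite subrK => /le_trans; apply.
rewrite [leLHS]addrC lerD2l.
by rewrite /V_in_c00 -rmorphB mu_le_A.
Qed.

Lemma c00_ext_exists : exists p : {poly R} -> R,
  pseudonorm_for idfun p /\ forall v, p (V_in_c00 v) = mu v.
Proof. by exists N. Qed.

End Existence.
End Extension.

Definition pseudonorms (R : realType) : set {ptws {poly rat} -> R} :=
  [set mu | pseudonorm_for ratr mu].

(* The space of all pseudonorms on V: the library gives a set coerced to a
   type the subspace topology, here inherited from pointwise convergence. *)
Definition calP (R : realType) : topologicalType := set_type (@pseudonorms R).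

Section BanachOfPseudonorm.
Variables (R : realType) (mu : calP R).

Lemma c00_ext_ex : exists p : {poly R} -> R,
  pseudonorm_for idfun p /\ forall v, p (V_in_c00 R v) = val mu v.
Proof. exact: c00_ext_exists (set_valP mu). Qed.

(* The only pseudonorm on c_00 extending mu, by [c00_ext_unique]. *)
Definition c00_ext : {poly R} -> R := sval (cid c00_ext_ex).

Lemma c00_extP : pseudonorm_for idfun c00_ext.
Proof. by rewrite /c00_ext; case: cid => p []. Qed.

Lemma c00_extE v : c00_ext (V_in_c00 R v) = val mu v.
Proof. by rewrite /c00_ext; case: cid => p []. Qed.

(* X_mu; [c00_in_X] is the canonical map from c_00, see [norm_c00_in_X] and
   [dense_c00_in_X]. *)
Definition banach_of : completeNormedModType R := completion (pn_quot c00_extP).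

Definition c00_in_X (x : {poly R}) : banach_of := completion_in (\pi_(pn_quot c00_extP) x).

Lemma c00_in_X_linear : linear c00_in_X.
Proof. by move=> a x y; rewrite /c00_in_X !linearP. Qed.

HB.instance Definition _ :=
  GRing.isLinear.Build R {poly R} banach_of _ c00_in_X c00_in_X_linear.

Lemma norm_c00_in_X x : `|c00_in_X x| = c00_ext x.
Proof. by rewrite /c00_in_X norm_completion_in norm_pn_pi. Qed.

Lemma dense_c00_in_X : dense (range c00_in_X).
Proof.
move=> U U0 oU; have [y [Uy [q _ qy]]] := dense_completion_in U0 oU.
by exists y; split=> //; exists (repr q); rewrite // /c00_in_X reprK.
Qed.

End BanachOfPseudonorm.

Section BanachSpaces.
Variable R : realType.

(* X and Y are linearly isometric (onto). *)
Definition isometric (X Y : normedModType R) : Prop :=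
  exists T : {linear X -> Y}, bijective T /\ forall x, `|T x| = `|x|.

Definition findim_subspace (X : normedModType R) (E : set X) : Prop :=
  exists (n : nat) (b : 'I_n -> X),
    E = range (fun c : 'I_n -> R => \sum_(i < n) c i *: b i).

Definition infinite_dimensional (X : normedModType R) : Prop :=
  ~ findim_subspace [set: X].

Definition separable (X : normedModType R) : Prop :=
  exists2 D : set X, countable D & dense D.

(* T is a surjective K-isomorphism from the subspace E onto the subspace F;
   its values outside E are irrelevant. *)
Definition isomorphism_onto (X Y : normedModType R) (K : R)
    (E : set X) (F : set Y) (T : X -> Y) : Prop :=
  [/\ forall a x y, E x -> E y -> T (a *: x + y) = a *: T x + T y,
      forall x, E x -> K^-1 * `|x| <= `|T x| <= K * `|x|
    & T @` E = F].

(* The family G is indexed because [set (completeNormedModType R)] is not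
   well-typed, for universe reasons. *)
Definition finitely_representable (X : completeNormedModType R)
    (I : Type) (J : set I) (G : I -> completeNormedModType R) : Prop :=
  forall (E : set X) (eps : R), findim_subspace E -> 0 < eps ->
  exists2 j, J j &
  exists2 F : set (G j), findim_subspace F &
  exists T : X -> G j, isomorphism_onto (1 + eps) E F T.

Definition finitely_representable_in_space (X Y : completeNormedModType R) :=
  finitely_representable X [set: unit] (fun=> Y).

Definition finitely_representable_in (X : completeNormedModType R)
    (F : set (calP R)) :=
  finitely_representable X F (@banach_of R).

Definition calPinf : set (calP R) :=
  [set mu | infinite_dimensional (banach_of mu)].

Definition calB : set (calP R) :=
  [set mu | calPinf mu /\ forall x, c00_ext mu x = 0 -> x = 0].

End BanachSpaces.
Arguments calPinf : clear implicits.
Arguments calB : clear implicits.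

(* Main.v *)
Require Import Defs.
From HB Require Import structures.
From mathcomp Require Import all_boot all_order all_algebra.
From mathcomp Require Import lra interval_inference.
From mathcomp Require Import all_classical all_reals topology normedtype sequences.

(** If [T] almost preserves the norm on the span of the first [n] basis vectors
    of [X_nu], complete the images of these vectors to a sequence [x] of dense
    span in the target [Y]; then [v |-> `|\sum_k v_k x_k|] is a pseudonorm close
    to [nu] on [V_n], and its Banach space is [Y].  When membership in [calB] is
    required, [x] is moreover chosen linearly independent.  Conversely, perturb
    a basis of a finite-dimensional [E] into [c_00]: on its span, pseudonorms
    close to [nu] at finitely many points are uniformly close to [nu], since the
    unit sphere of the coordinate space is compact. *)

Set Implicit Arguments.
Unset Strict Implicit.
Unset Printing Implicit Defensive.

Import Order.TTheory GRing.Theory Num.Theory.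
Import numFieldNormedType.Exports.

Local Open Scope classical_set_scope.
Local Open Scope ring_scope.

(** * Density in normed spaces *)

Section Density.
Variables (R : realType) (X : normedModType R).

Lemma dense_rangeP (T : Type) (f : T -> X) :
  dense (range f) <-> forall x (e : R), 0 < e -> exists t, `|x - f t| < e.
Proof.
split=> [fd x e e0|fd O [x Ox] oO].
  have [|y [xy [t _ ty]]] := fd _ _ (ball_open x e).
    by exists x; exact: ballxx.
  by exists t; move: xy; rewrite -ball_normE /= ty.
have := open_nbhs_nbhs (conj oO Ox); rewrite -nbhs_ballE => -[e /= e0 eO].
have [t xt] := fd x e e0; exists (f t); split; last by exists t.
by apply: eO; rewrite -ball_normE.
Qed.

Lemma norm_small_eq0 (x : X) : (forall e : R, 0 < e -> `|x| <= e) -> x = 0.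
Proof.
by move=> xe; apply/eqP; rewrite -normr_le0; apply/ler_addgt0Pr => e /xe; rewrite add0r.
Qed.

End Density.

(** * Isometries defined on dense subspaces *)

Section Isometries.
Variables (R : realType) (E : lmodType R).

(** [A] may have a kernel, but equal norms make [B e] depend only on [A e]. The values of [T] are
    limits in the complete space [Y], and both linearity and the norm equality follow from one
    inequality comparing [T x - B e] with [x - A e]. *)
Lemma isometry_extension (X : normedModType R) (Y : completeNormedModType R)
    (A : {linear E -> X}) (B : {linear E -> Y}) :
    (forall e, `|A e| = `|B e|) -> dense (range A) ->
  exists T : {linear X -> Y}, (forall x, `|T x| = `|x|) /\ forall e, T (A e) = B e.
Proof.
move=> AB /dense_rangeP dA.
have ABB e f : `|B e - B f| = `|A e - A f| by rewrite -!linearB AB.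
(* Density of the range of A makes this inequality determine T x. *)
have /choice[T hT] : forall x, exists y, forall e, `|y - B e| <= `|x - A e|.
  move=> x.
  have /choice[p hp] : forall n, exists e, `|x - A e| < n.+1%:R^-1.
    by move=> n; apply: dA; rewrite invr_gt0.
  have small (e : R) : 0 < e -> exists N, forall n, (N <= n)%N -> `|x - A (p n)| < e.
    move=> /posnumP[{}e]; have [N _ hN] := near_infty_natSinv_lt e.
    by exists N => n Nn; exact: lt_trans (hp n) (hN n Nn).
  have : is_cauchy_seq (B \o p).
    apply/is_cauchy_seqP => e e0.
    have [N hN] := small _ (divr_gt0 e0 (ltr0n R 2)).
    exists N => m n Nm Nn; rewrite /= ABB -(subrKA x) [ltRHS]splitr.
    by rewrite (le_lt_trans (ler_normD _ _)) // ltrD ?hN // distrC hN.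
  move=> /asboolP/cauchy_cvg/cvg_ex[y py]; exists y => e.
  apply/ler_addgt0Pr => d d0.
  have d2 := divr_gt0 d0 (ltr0n R 2).
  have [N hN] := small _ d2.
  have /cvgrPdist_lt/(_ _ d2)[M _ hM] := py.
  have := hM _ (leq_maxr N M); have := hN _ (leq_maxl N M) => /=.
  set q := p _ => xq yq.
  have qe : `|A q - A e| <= d / 2 + `|x - A e|.
    rewrite -(subrKA x (A q)) (le_trans (ler_normD _ _)) // lerD2r.
    by rewrite distrC ltW.
  rewrite -(subrKA (B q)) (le_trans (ler_normD _ _)) // ABB.
  by rewrite [d]splitr [leRHS]addrC -[leRHS]addrA lerD // ltW.
have Tlin : linear T.
  move=> a x y; apply/eqP; rewrite -subr_eq0; apply/eqP/norm_small_eq0 => d d0.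
  (* The defect of linearity is bounded by two errors of size [|a| * r] and two of size [r]; this
     denominator makes them add up to [d]. *)
  have a0 : 0 < 2 * (`|a| + 1) by rewrite mulr_gt0 // ltr_wpDl.
  have := divr_gt0 d0 a0; set r := _ / _ => r0.
  have [e /ltW xe] := dA x r r0; have [f /ltW yf] := dA y r r0.
  have axe : `|a *: (x - A e)| <= `|a| * r by rewrite normrZ ler_wpM2l.
  have aTe : `|a *: (T x - B e)| <= `|a| * r.
    by rewrite normrZ ler_wpM2l // (le_trans (hT x e)).
  have -> : d = (`|a| * r + r) + (`|a| * r + r).
    by rewrite -{2 4}[r]mul1r -mulrDl -mulr2n -mulr_natl mulrA mulrC divfK ?gt_eqF.
  have -> : T (a *: x + y) - (a *: T x + T y) =
     (T (a *: x + y) - B (a *: e + f)) - (a *: (T x - B e) + (T y - B f)).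
    by rewrite (linearP B) scalerBr [X in _ = _ - X]addrACA -opprD opprB subrKA.
  rewrite (le_trans (ler_normB _ _)) // lerD //.
    rewrite (le_trans (hT _ _)) // (linearP A) opprD addrACA -scalerBr.
    by rewrite (le_trans (ler_normD _ _)) // lerD.
  by rewrite (le_trans (ler_normD _ _)) // lerD // (le_trans (hT y f)).
pose linT := GRing.isLinear.Build R X Y _ T Tlin.
exists (HB.pack T linT : {linear X -> Y}).
split=> [x|e] /=.
  apply/eqP; rewrite -subr_eq0 -normr_le0; apply/ler_addgt0Pr => d d0.
  have [e xe] := dA x _ (divr_gt0 d0 (ltr0n R 2)).
  rewrite add0r -(subrKA `|A e|) [d]splitr (le_trans (ler_normD _ _)) // lerD //.
    by rewrite AB (le_trans (ler_dist_dist _ _)) // (le_trans (hT x e)) ?ltW.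
  by rewrite (le_trans (ler_dist_dist _ _)) // distrC ltW.
by apply/eqP; rewrite -subr_eq0 -normr_le0 (le_trans (hT _ e)) // subrr normr0.
Qed.

Lemma isometry_extension_cancel (X Y : completeNormedModType R)
    (A : {linear E -> X}) (B : {linear E -> Y})
    (T : {linear X -> Y}) (S : {linear Y -> X}) :
  dense (range A) -> (forall x, `|T x| = `|x|) -> (forall y, `|S y| = `|y|) ->
  (forall e, T (A e) = B e) -> (forall e, S (B e) = A e) -> cancel T S.
Proof.
move=> /dense_rangeP dA nT nS TA SB x.
apply/eqP; rewrite -subr_eq0; apply/eqP/norm_small_eq0 => d d0.
have [e /ltW xe] := dA x _ (divr_gt0 d0 (ltr0n R 2)).
rewrite -(subrKA (A e)) [d]splitr (le_trans (ler_normD _ _)) // lerD //.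
  by rewrite -{1}SB -TA -!linearB nS nT.
by rewrite distrC.
Qed.

Lemma isometric_of_dense (X Y : completeNormedModType R)
    (A : {linear E -> X}) (B : {linear E -> Y}) :
  (forall e, `|A e| = `|B e|) -> dense (range A) -> dense (range B) -> isometric X Y.
Proof.
move=> AB dA dB.
have [T [nT TA]] := isometry_extension AB dA.
have [S [nS SB]] := isometry_extension (fun e => esym (AB e)) dB.
exists T; split=> //; exists S.
  exact: isometry_extension_cancel dA nT nS TA SB.
exact: isometry_extension_cancel dB nS nT SB TA.
Qed.

End Isometries.

(** * Linear combinations with polynomial coefficients *)

Section Lincomb.
Variables (R : realType) (X : lmodType R).
Implicit Types (x : nat -> X) (p : {poly R}).

(** Polynomials being finitely supported sequences, this is the linear map from c_00 that sends e_k
    to [x k]. *)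
Definition lincomb x p : X := \sum_(k < size p) p`_k *: x k.

Lemma lincombE n x p : (size p <= n)%N -> lincomb x p = \sum_(k < n) p`_k *: x k.
Proof.
move=> pn; rewrite /lincomb (big_ord_widen _ (fun k => p`_k *: x k) pn).
rewrite big_mkcond; apply: eq_bigr => k _; case: ltnP => // pk.
by rewrite nth_default // scale0r.
Qed.

Lemma lincomb_linear x : linear (lincomb x).
Proof.
move=> a p q; have pqn := leq_trans (size_polyD (a *: p) q).
rewrite (lincombE _ (leq_maxl (size p) (size q))).
rewrite (lincombE _ (leq_maxr (size p) (size q))).
rewrite (@lincombE (maxn (size p) (size q))); last first.
  by rewrite pqn // geq_max leq_maxr leq_max size_scale_leq.
rewrite scaler_sumr -big_split /=; apply: eq_bigr => k _.
by rewrite coefD coefZ scalerDl scalerA.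
Qed.

HB.instance Definition _ x :=
  GRing.isLinear.Build R {poly R} X _ (lincomb x) (lincomb_linear x).

Lemma lincomb_poly x n (c : nat -> R) :
  lincomb x (\poly_(k < n) c k) = \sum_(k < n) c k *: x k.
Proof.
rewrite (lincombE _ (size_poly n c)); apply: eq_bigr => k _.
by rewrite coef_poly ltn_ord.
Qed.

Lemma lincombXn x n : lincomb x 'X^n = x n.
Proof.
rewrite (@lincombE n.+1) ?size_polyXn // big_ord_recr /= coefXn eqxx scale1r.
by rewrite big1 ?add0r // => k _; rewrite coefXn ltn_eqF // scale0r.
Qed.

Lemma eq_lincomb x y p : (forall k, (k < size p)%N -> x k = y k) ->
  lincomb x p = lincomb y p.
Proof. by move=> xy; apply: eq_bigr => k _; rewrite xy. Qed.

End Lincomb.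

Lemma linear_lincomb (R : realType) (X Y : lmodType R) (f : {linear X -> Y})
  (x : nat -> X) p : f (lincomb x p) = lincomb (f \o x) p.
Proof. by rewrite linear_sum; apply: eq_bigr => k _; rewrite linearZ. Qed.

Lemma lincomb_polyXn (R : realType) (p : {poly R}) : lincomb (fun k => 'X^k) p = p.
Proof. by rewrite /lincomb -poly_def coefK. Qed.

(** * Pseudonorms induced by sequences of vectors *)

Section SequencePseudonorm.
Variables (R : realType) (X : normedModType R) (x : nat -> X).

Lemma lincomb_pseudonorm : pseudonorm_for idfun (fun p => `|lincomb x p|).
Proof. by split=> [p q|a p]; rewrite ?linearD ?ler_normD // linearZ normrZ. Qed.

Lemma seq_pn_subproof : pseudonorms (R := R) (fun v => `|lincomb x (V_in_c00 R v)|).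
Proof.
split=> [v w|a v]; rewrite /V_in_c00.
  by rewrite rmorphD linearD ler_normD.
by rewrite map_polyZ linearZ normrZ.
Qed.

Definition seq_pn : calP R :=
  @exist _ (fun f => is_true (f \in @pseudonorms R)) _ (mem_set seq_pn_subproof).

(** The right-hand side is a pseudonorm on all of c_00, so uniqueness of the extension applies. *)
Lemma c00_ext_seq_pn p : c00_ext seq_pn p = `|lincomb x p|.
Proof.
have := c00_ext_unique (c00_extP seq_pn) lincomb_pseudonorm.
by move=> /(_ (c00_extE seq_pn)) ->.
Qed.

End SequencePseudonorm.

(** [c00_in_X] and [lincomb x] are two maps on c_00 with dense range that induce the same
    pseudonorm. *)
Lemma isometric_seq_pn (R : realType) (X : completeNormedModType R) (x : nat -> X) :
  dense (range (lincomb x)) -> isometric (banach_of (seq_pn x)) X.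
Proof.
move=> dx; apply: (@isometric_of_dense R {poly R} _ _ (@c00_in_X R _) (lincomb x)) => //.
  by move=> p; rewrite norm_c00_in_X c00_ext_seq_pn.
exact: dense_c00_in_X.
Qed.

Lemma isometric_infinite_dimensional (R : realType) (X Y : normedModType R) :
  isometric X Y -> infinite_dimensional Y -> infinite_dimensional X.
Proof.
move=> [T [[S TK SK] _]] iY [n [b Xb]]; apply: iY; exists n, (T \o b).
apply/seteqP; split=> // y _.
have : [set: X] (S y) by [].
rewrite Xb => -[c _ cy]; exists c => //; rewrite -(SK y) -cy linear_sum.
by apply: eq_bigr => i _; rewrite linearZ.
Qed.

Lemma dense_lincombS (R : realType) (X : normedModType R) (x y : nat -> X) :
  (forall k, exists p, lincomb y p = x k) ->
  dense (range (lincomb x)) -> dense (range (lincomb y)).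
Proof.
move=> /choice[P yP] dx O O0 oO; have [z [Oz [p _ pz]]] := dx O O0 oO.
exists z; split=> //; exists (lincomb P p) => //.
by rewrite -pz linear_lincomb; apply: eq_lincomb => k _; exact: yP.
Qed.

Lemma dense_lincomb_banach_of (R : realType) (mu : calP R) :
  dense (range (lincomb (fun k => c00_in_X mu 'X^k))).
Proof.
rewrite (_ : lincomb _ = c00_in_X mu); first exact: dense_c00_in_X.
apply/funext => p; rewrite -[in RHS](lincomb_polyXn p).
by rewrite (linear_lincomb (@c00_in_X R mu)).
Qed.

(** * Linearly independent sequences with dense span *)

Section FreeSequences.
Variables (R : realType) (X : normedModType R).
Implicit Types (x y : nat -> X).

Definition free_seq n x :=
  forall p : {poly R}, (size p <= n)%N -> lincomb x p = 0 -> p = 0.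

(** Dividing a nontrivial relation by its leading coefficient expresses some [y k] through earlier
    terms. *)
Lemma free_seqP y :
  (forall k (q : {poly R}), y k <> \sum_(i < k) q`_i *: y i) ->
  forall p : {poly R}, lincomb y p = 0 -> p = 0.
Proof.
move=> fy p; apply: contra_eq => p0; apply/eqP.
move sp : (size p) => [|k]; first by move/eqP: sp p0; rewrite size_poly_eq0 => ->.
have pk : p`_k != 0 by move: p0; rewrite -lead_coef_eq0 lead_coefE sp.
rewrite /lincomb sp big_ord_recr /= => /eqP; rewrite addrC addr_eq0 => /eqP ypk.
apply: (fy k ((- (p`_k)^-1) *: p)); rewrite -[LHS](scalerK pk) ypk scalerN.
by rewrite -scaleNr scaler_sumr; apply: eq_bigr => i _; rewrite coefZ scalerA.
Qed.

(** Greedy choice: an [x k] that depends on the earlier selection is replaced by any vector outside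
    its span, which exists because finitely many vectors cannot span [X]. *)
Lemma free_selection x : infinite_dimensional X -> exists y, forall k,
  (forall q : {poly R}, y k <> \sum_(i < k) q`_i *: y i) /\
  (y k = x k \/ exists q : {poly R}, x k = \sum_(i < k) q`_i *: y i).
Proof.
move=> iX.
pose S (s : seq X) z := exists q : {poly R}, z = \sum_(i < size s) q`_i *: s`_i.
have /choice[f hf] : forall vs : X * seq X,
    exists z, ~ S vs.2 z /\ (z = vs.1 \/ S vs.2 vs.1).
  move=> [v s] /=; have [sv|sv] := pselect (S s v); last by exists v; split=> //; left.
  have [[z sz]|] := pselect (exists z, ~ S s z); first by exists z; split=> //; right.
  move=> /forallNP sX; case: iX; exists (size s), (fun i => s`_i).
  apply/seteqP; split=> // z _; have /contrapT[q ->] := sX z.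
  by exists (fun i => q`_i).
(* [L k] lists the first [k] selected vectors, so that each choice can depend on all earlier
   ones. *)
pose L := fix L k := if k is k'.+1 then rcons (L k') (f (x k', L k')) else [::].
pose y k := f (x k, L k).
have Ly k : L k = mkseq y k by elim: k => //= k IH; rewrite mkseqS -IH.
have Sy k z : S (L k) z -> exists q : {poly R}, z = \sum_(i < k) q`_i *: y i.
  rewrite Ly => -[q ->]; exists q; rewrite size_mkseq; apply: eq_bigr => i _.
  by rewrite nth_mkseq.
exists y => k; have [/= h1 h2] := hf (x k, L k); split.
  move=> q yq; apply: h1; exists q; rewrite -/(y k) yq Ly size_mkseq.
  by apply: eq_bigr => i _; rewrite nth_mkseq.
by case: h2 => h2; [left|right; exact: Sy].
Qed.

(* A vector is kept unless it depends on the vectors selected before it, so the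
   free vectors at the head of the sequence are all kept. *)
Lemma free_dense_seq n x : infinite_dimensional X -> free_seq n x ->
  dense (range (lincomb x)) ->
  exists y, [/\ forall k, (k < n)%N -> y k = x k,
    forall p : {poly R}, lincomb y p = 0 -> p = 0 & dense (range (lincomb y))].
Proof.
move=> iX fx dx; have [y hy] := free_selection x iX.
exists y; split.
- move=> k; elim/ltn_ind: k => k IH kn; have [//|[q xq]] := (hy k).2.
  (* If [x k] had been replaced, this would be a relation among the first [n] vectors of [x] whose
     coefficient at [k] is 1, against freeness. *)
  have : lincomb x ('X^k - \poly_(i < k) q`_i) = 0.
    rewrite linearB /= lincombXn lincomb_poly xq; apply/eqP; rewrite subr_eq0.
    by apply/eqP/eq_bigr => i _; rewrite IH // (ltn_trans _ kn).
  move=> /fx => /(_ _)/(congr1 (fun p : {poly R} => p`_k)).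
  rewrite coefB coefXn coef_poly ltnn eqxx subr0 coef0 => h.
  suff : (1 : R) = 0 by move/eqP; rewrite oner_eq0.
  apply: h; rewrite (leq_trans (size_polyD _ _)) // size_polyN size_polyXn.
  by rewrite geq_max kn (leq_trans (size_poly _ _)) // ltnW.
- by apply: free_seqP => k; exact: (hy k).1.
- apply: dense_lincombS dx => k; have [<-|[q ->]] := (hy k).2.
    by exists 'X^k; rewrite lincombXn.
  by exists (\poly_(i < k) q`_i); rewrite lincomb_poly.
Qed.

Lemma prepend_dense_seq n x (d : nat -> X) : dense (range (lincomb d)) -> exists y,
  (forall k, (k < n)%N -> y k = x k) /\ dense (range (lincomb y)).
Proof.
move=> dd; exists (fun k => if (k < n)%N then x k else d (k - n)%N); split.
  by move=> k ->.
apply: dense_lincombS dd => k; exists 'X^(n + k).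
by rewrite lincombXn ltnNge leq_addr /= addKn.
Qed.

End FreeSequences.

(** * Pointwise convergence of pseudonorms *)

Section PointwiseTopology.
Variable R : realType.
Implicit Types (mu nu : calP R) (F : set (calP R)).

Lemma val_calP_continuous : continuous (val : calP R -> {ptws {poly rat} -> R}).
Proof. exact: (@initial_continuous (calP R) {ptws {poly rat} -> R} val). Qed.

Lemma near_calP nu (v : {poly rat}) (e : R) : 0 < e ->
  \forall mu \near nu, `|val nu v - val mu v| < e.
Proof.
move=> e0; apply: (@cvgr_dist_lt _ _ _ (nbhs nu) _ (fun mu => val mu v)) => //.
apply: (@continuous_comp (calP R) {ptws {poly rat} -> R} R val (fun f => f v)).
  exact: val_calP_continuous.
exact: (@proj_continuous {poly rat} (fun=> R) v).
Qed.

(** The chosen pseudonorms form a sequence converging to [nu]: each [v] has size at most [n] for all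
    large [n], and the relative error tends to 0. *)
Lemma closure_calP F nu :
  (forall n, exists2 mu, F mu & forall v : {poly rat}, (size v <= n)%N ->
     `|val nu v - val mu v| <= n.+1%:R^-1 * val nu v) ->
  closure F nu.
Proof.
move=> /(_ _)/cid2-/all_sig2[u Fu hu].
have cu : (fun n => val (u n) : {ptws {poly rat} -> R}) @ \oo --> val nu.
  (* The product topology is the supremum of those induced by the evaluations, each of which is
     surjective. *)
  apply/cvg_sup => v; apply/cvg_image.
    by apply/seteqP; split=> // r _; exists (fun=> r).
  move=> B /nbhs_ballP[e /= e0 eB].
  have d0 : 0 < e / (`|val nu v| + 1) by rewrite divr_gt0 // ltr_wpDl.
  exists ((fun f => f v) @^-1` B); last first.
    by rewrite image_preimage //; apply/seteqP; split=> // r _; exists (fun=> r).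
  suff : \forall n \near \oo, B (val (u n) v) by [].
  near=> n; apply: eB; rewrite -ball_normE /=.
  have vn : (size v <= n)%N by near: n; exact: nbhs_infty_ge.
  rewrite (le_lt_trans (hu n v vn)) //.
  apply: (@le_lt_trans _ _ (n.+1%:R^-1 * (`|val nu v| + 1))).
    by rewrite ler_wpM2l ?invr_ge0 // (le_trans (ler_norm _)) // lerDl.
  rewrite -ltr_pdivlMr ?ltr_wpDl //.
  by near: n; exact: (near_infty_natSinv_lt (PosNum d0)).
move=> B; rewrite nbhsE => -[_ [[W oW <-] Wnu] WB].
have /cu[N _ hN] : nbhs (val nu : {ptws {poly rat} -> R}) W by apply: open_nbhs_nbhs.
by exists (u N); split; [exact: Fu | apply: WB; exact: hN N (leqnn N)].
Unshelve. all: by end_near. Qed.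

End PointwiseTopology.

(** * From finite representability to the closure *)

Section FiniteRepresentability.
Variable R : realType.

Lemma findim_poly_image (X : normedModType R) (A : {linear {poly R} -> X}) n :
  findim_subspace (A @` [set p : {poly R} | (size p <= n)%N]).
Proof.
exists n, (fun i => A 'X^i); apply/seteqP; split=> [_ [p pn <-]|_ [c _ <-]].
  exists (fun i => p`_i) => //; rewrite -{2}[p](lincomb_polyXn p) linear_lincomb.
  by rewrite (lincombE _ pn).
exists (\sum_(i < n) c i *: 'X^i) => /=.
  rewrite (leq_trans (size_sum _ _ _)) //; apply/bigmax_leqP => i _.
  by rewrite (leq_trans (size_scale_leq _ _)) // size_polyXn.
by rewrite linear_sum; apply: eq_bigr => i _; rewrite linearZ.
Qed.

(** Finite representability is applied to the span of the first [n] vectors [A 'X^k], and [x]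
    consists of their images. *)
Lemma finitely_representable_seq (X : completeNormedModType R) (A : {linear {poly R} -> X})
    (I : Type) (J : set I) (G : I -> completeNormedModType R) n (eps : R) :
  finitely_representable X J G -> 0 < eps ->
  exists2 j, J j & exists x : nat -> G j, forall p : {poly R}, (size p <= n)%N ->
    (1 + eps)^-1 * `|A p| <= `|lincomb x p| <= (1 + eps) * `|A p|.
Proof.
move=> XG eps0; have [j Jj [F _ [T [Tlin Tiso _]]]] := XG _ _ (findim_poly_image A n) eps0.
exists j => //; exists (fun k => T (A 'X^k)) => p pn.
set E := A @` _ in Tlin Tiso.
have EA (q : {poly R}) : (size q <= n)%N -> E (A q) by move=> qn; exists q.
have T0 : T 0 = 0.
  have E0 : E 0 by rewrite -(linear0 A); apply: EA; rewrite size_poly0.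
  have := Tlin 1 _ _ E0 E0; rewrite scaler0 addr0 scale1r => T0.
  by apply: (addIr (T 0)); rewrite add0r.
suff -> : lincomb (fun k => T (A 'X^k)) p = T (A p) by apply: Tiso; exact: EA.
rewrite (lincombE _ pn) -{2}[p](lincomb_polyXn p) linear_lincomb (lincombE _ pn).
(* [T] is linear only on [E], so membership of the partial sums in [E] is carried through the
   induction. *)
suff [_ ->] : E (\sum_(k < n) p`_k *: A 'X^k) /\
   T (\sum_(k < n) p`_k *: A 'X^k) = \sum_(k < n) p`_k *: T (A 'X^k) by [].
elim/big_ind2 : _ => [|x1 x2 y1 y2 [Ex1 <-] [Ey1 <-]|k _].
- by split=> //; rewrite -(linear0 A); apply: EA; rewrite size_poly0.
- split; last by have := Tlin 1 _ _ Ex1 Ey1; rewrite !scale1r.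
  move: Ex1 Ey1 => -[p1 p1n <-] [p2 p2n <-]; rewrite -linearD; apply: EA.
  by rewrite (leq_trans (size_polyD _ _)) // geq_max p1n.
- have Ek : E (A 'X^k) by apply: EA; rewrite size_polyXn.
  have E0 : E 0 by rewrite -(linear0 A); apply: EA; rewrite size_poly0.
  split; last by have := Tlin p`_k _ _ Ek E0; rewrite T0 !addr0.
  rewrite -linearZ; apply: EA.
  by rewrite (leq_trans (size_scale_leq _ _)) // size_polyXn.
Qed.

(** The three choices of [I] differ only at the end: nothing more is needed for all of [calP],
    infinite dimension is inherited from [G j], and [calB] asks in addition for a linearly
    independent sequence. *)
Lemma finitely_representable_closure (I : set (calP R)) (K : Type) (J : set K)
    (G : K -> completeNormedModType R) nu :
  [\/ I = calB R, I = calPinf R | I = [set: calP R]] -> I nu ->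
  (I `<=` calPinf R -> forall j, J j -> infinite_dimensional (G j)) ->
  (forall j, J j -> exists d : nat -> G j, dense (range (lincomb d))) ->
  finitely_representable (banach_of nu) J G ->
  closure [set mu | I mu /\ exists2 j, J j & isometric (banach_of mu) (G j)] nu.
Proof.
move=> hI Inu iG dG nuG; apply: closure_calP => n.
have e0 : 0 < n.+1%:R^-1 :> R by rewrite invr_gt0.
have [j Jj [x hx]] := finitely_representable_seq (@c00_in_X R nu) n nuG e0.
have [d dd] := dG j Jj.
suff [y [yx dy Iy]] : exists y, [/\ forall k, (k < n)%N -> y k = x k,
    dense (range (lincomb y)) & I (seq_pn y)].
  exists (seq_pn y).
    by split=> //; exists j => //; exact: isometric_seq_pn.
  move=> v vn.
  have wn : (size (V_in_c00 R v) <= n)%N by rewrite (leq_trans (size_poly _ _)).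
  rewrite -!c00_extE c00_ext_seq_pn; move: (hx _ wn); rewrite norm_c00_in_X.
  rewrite (@eq_lincomb _ _ y x) => [|k kv]; last by rewrite yx // (leq_trans kv).
  set t := c00_ext _ _; set e := n.+1%:R^-1; rewrite mulrDl mul1r => /andP[h1 h2].
  have t0 : 0 <= t by rewrite /t -norm_c00_in_X.
  rewrite ler_distlC h2 andbT (le_trans _ h1) //.
  (* The lower bound uses [1 - e <= (1 + e)^-1], that is, [(1 - e) * (1 + e) <= 1]. *)
  rewrite -{1}[t]mul1r -mulrBl ler_wpM2r // -div1r ler_pdivlMr ?addr_gt0 //.
  by rewrite mulrDr mulr1 mulrBl mul1r addrA subrK gerBl mulr_ge0 // ltW.
have [y [yx dy]] := prepend_dense_seq n x dd.
have iso := isometric_seq_pn dy.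
case: hI => IE; subst I; last by exists y.
  have iGj : infinite_dimensional (G j) by apply: iG Jj => mu [].
  have [p pn xp|z [zy fz dz]] := free_dense_seq (n := n) iGj _ dy.
    (* The first [n] vectors are independent: by the lower bound in [hx] a relation [p] among them
       has [nu]-norm 0, and [nu] is a norm on c_00. *)
    apply: Inu.2; apply/eqP; rewrite eq_le -norm_c00_in_X normr_ge0 andbT.
    have := hx p pn; rewrite -(eq_lincomb (x := y)) => [|k kp]; last first.
      by rewrite yx // (leq_trans kp).
    by rewrite xp normr0 pmulr_rle0 ?invr_gt0 ?addr_gt0 // => /andP[].
  exists z; split=> //; first by move=> k kn; rewrite zy ?yx.
  split; first exact: isometric_infinite_dimensional (isometric_seq_pn dz) iGj.
  by move=> p /eqP; rewrite c00_ext_seq_pn normr_eq0 => /eqP/fz.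
exists y; split=> //; apply: isometric_infinite_dimensional iso _.
exact: iG Jj.
Qed.

End FiniteRepresentability.

(** * Continuity of evaluation at points of c_00 *)

Section NearPseudonorm.
Variables (R : realType) (nu : calP R).

(** One rational approximant serves all pseudonorms near [nu], because their values at each ['X^k]
    stay below [val nu 'X^k + 1]. *)
Lemma near_V_approx (p : {poly R}) (e : R) : 0 < e ->
  exists v : {poly rat}, \forall mu \near nu, c00_ext mu (p - V_in_c00 R v) < e.
Proof.
rewrite -[p]coefK poly_def; move: e.
elim/big_ind : _ => [|y z hy hz|k _] e e0.
- exists 0; near=> mu; rewrite /V_in_c00 rmorph0 subr0.
  by rewrite -norm_c00_in_X linear0 normr0.
- have e2 := divr_gt0 e0 (ltr0n R 2).
  have [v hv] := hy _ e2; have [w hw] := hz _ e2; exists (v + w).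
  near=> mu; rewrite /V_in_c00 rmorphD /= opprD addrACA.
  rewrite (le_lt_trans ((c00_extP mu).1 _ _)) // [ltRHS]splitr.
  by apply: ltrD; [near: mu | near: mu].
- have w0 : 0 < val nu 'X^k + 1.
    by rewrite ltr_wpDl // -c00_extE -norm_c00_in_X.
  have d0 := divr_gt0 e0 w0; set d := _ / _ in d0.
  have [|q] := @rat_in_itvoo R (p`_k - d) p`_k; first by rewrite ltrBlDr ltrDl.
  rewrite in_itv /= => /andP[h1 h2]; exists (q *: 'X^k); near=> mu.
  have muk : val mu 'X^k < val nu 'X^k + 1.
    have : `|val nu 'X^k - val mu 'X^k| < 1 by near: mu; exact: near_calP.
    by rewrite ltr_distlC => /andP[].
  have -> : p`_k *: 'X^k - V_in_c00 R (q *: 'X^k) = (p`_k - ratr q) *: V_in_c00 R 'X^k.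
    by rewrite /V_in_c00 map_polyZ /= map_polyXn scalerBl.
  rewrite (c00_extP mu).2 /= c00_extE ger0_norm ?subr_ge0 ?ltW //.
  apply: (@le_lt_trans _ _ ((p`_k - ratr q) * (val nu 'X^k + 1))).
    by rewrite ler_wpM2l ?subr_ge0 // ltW.
  by rewrite -ltr_pdivlMr // ltrBlDr -ltrBlDl.
Unshelve. all: by end_near. Qed.

(** The topology only controls values on V, so [nu] and [mu] are compared at a common rational
    approximant of [p]. *)
Lemma near_c00_ext (p : {poly R}) (e : R) : 0 < e ->
  \forall mu \near nu, `|c00_ext nu p - c00_ext mu p| < e.
Proof.
move=> e0.
have [v hv] := near_V_approx p (divr_gt0 e0 (ltr0n R 4)).
have pv mu : `|c00_ext mu p - val mu v| <= c00_ext mu (p - V_in_c00 R v).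
  by rewrite -c00_extE; exact: (pseudonorm_dist (i := idfun) (c00_extP mu)).
have hnu := nbhs_singleton hv.
near=> mu.
have hmu : c00_ext mu (p - V_in_c00 R v) < e / 4 by near: mu.
have nm : `|val nu v - val mu v| < e / 4 by near: mu; apply: near_calP; rewrite divr_gt0.
have := pv mu; have := pv nu; rewrite !ler_norml; move: nm; rewrite ltr_norml.
move=> /andP[? ?] /andP[? ?] /andP[? ?]; rewrite ltr_norml; apply/andP; split; lra.
Unshelve. all: by end_near. Qed.

End NearPseudonorm.

(** * Coordinates in finite-dimensional subspaces *)

Section Coordinates.
Variable R : realType.

(** Coefficients are row vectors because these carry a norm whose unit sphere is compact. *)
Definition rcomb (V : lmodType R) n (b : 'I_n -> V) (a : 'rV[R]_n) : V :=
  \sum_(i < n) a 0 i *: b i.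

Lemma rcomb_linear (V : lmodType R) n (b : 'I_n -> V) : linear (rcomb b).
Proof.
move=> c u v; rewrite /rcomb scaler_sumr -big_split; apply: eq_bigr => i _ /=.
by rewrite !mxE scalerDl scalerA.
Qed.

HB.instance Definition _ (V : lmodType R) n (b : 'I_n -> V) :=
  GRing.isLinear.Build R 'rV[R]_n V _ (rcomb b) (rcomb_linear b).

Lemma linear_rcomb (V W : lmodType R) (f : {linear V -> W}) n (b : 'I_n -> V) a :
  f (rcomb b a) = rcomb (f \o b) a.
Proof. by rewrite linear_sum; apply: eq_bigr => i _; rewrite linearZ. Qed.

Lemma ler_norm_coord n (a : 'rV[R]_n) i : `|a 0 i| <= `|a|.
Proof.
rewrite [leRHS]/Num.norm /= mx_normrE.
exact: (le_bigmax _ (fun ij : 'I_1 * 'I_n => `|a ij.1 ij.2|) (0, i)).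
Qed.

Lemma ler_norm_rcomb (V : normedModType R) n (b : 'I_n -> V) (a : 'rV[R]_n) :
  `|rcomb b a| <= `|a| * \sum_(i < n) `|b i|.
Proof.
rewrite (le_trans (ler_norm_sum _ _ _)) // mulr_sumr; apply: ler_sum => i _.
by rewrite normrZ ler_wpM2r // ler_norm_coord.
Qed.

Lemma compact_sphere n : compact [set a : 'rV[R]_n | `|a| = 1].
Proof.
apply: bounded_closed_compact.
  by exists 1; split=> // x x1 a /= ->; exact: ltW.
apply: (@preimage_closed _ _ (fun a : 'rV[R]_n => `|a|) [set 1]).
  by move=> a _; exact: norm_continuous.
exact: closed_eq.
Qed.

(** The norm of [rcomb b a] is continuous and positive on the compact sphere, hence bounded below
    there; homogeneity does the rest. *)
Lemma basis_lower_bound (X : normedModType R) n (b : 'I_n -> X) :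
  (forall a, rcomb b a = 0 -> a = 0) ->
  exists2 c : R, 0 < c & forall a, c * `|a| <= `|rcomb b a|.
Proof.
move=> fb.
(* A Lipschitz constant of [rcomb b]; the added 1 keeps it positive when the sum is 0. *)
pose M := \sum_(i < n) `|b i| + 1.
have M0 : 0 < M by rewrite ltr_wpDl ?sumr_ge0.
have ncov := (compact_near_coveringP _).1 (@compact_sphere n).
have : \forall c \near (0 : R)^'+, [set a : 'rV[R]_n | `|a| = 1] `<=`
    (fun a => c < `|rcomb b a|).
  apply: ncov => a /= a1; have r0 : 0 < `|rcomb b a|.
    rewrite normr_gt0; apply: contra_eq_neq a1 => /fb ->.
    by rewrite normr0 eq_sym oner_eq0.
  have r2 := divr_gt0 r0 (ltr0n R 2); have d0 := divr_gt0 r2 M0.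
  near=> a' c => /=.
  have c1 : c < `|rcomb b a| / 2 by near: c; exact: nbhs_right_lt.
  have aa' : `|a - a'| < `|rcomb b a| / 2 / M by near: a'; exact: cvgr_dist_lt.
  apply: (lt_trans c1).
  have : `|rcomb b (a - a')| < `|rcomb b a| / 2.
    rewrite (le_lt_trans (ler_norm_rcomb _ _)) //.
    apply: (@le_lt_trans _ _ (`|a - a'| * M)); first by rewrite ler_wpM2l // lerDl.
    by rewrite -ltr_pdivlMr.
  by rewrite linearB /=; have := lerB_dist (rcomb b a) (rcomb b a'); lra.
move=> /(filterI (nbhs_right_gt 0))/filter_ex[c [c0 hc]].
exists c => // a; have [->|a0] := eqVneq a 0; first by rewrite linear0 !normr0 mulr0.
have a1 : 0 < `|a| by rewrite normr_gt0.
have /hc/ltW : [set u : 'rV[R]_n | `|u| = 1] (`|a|^-1 *: a).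
  by rewrite /= normrZ gtr0_norm ?invr_gt0 // mulVf ?gt_eqF.
by rewrite linearZ normrZ gtr0_norm ?invr_gt0 // ler_pdivlMl // mulrC.
Unshelve. all: by end_near. Qed.

Lemma findim_subspaceP (X : normedModType R) (E : set X) :
  findim_subspace E <-> exists n (b : 'I_n -> X), E = range (rcomb b).
Proof.
split=> -[n [b ->]]; exists n, b; apply/seteqP; split=> _ [c _ <-].
- by exists (\row_i c i) => //; apply: eq_bigr => i _; rewrite mxE.
- by exists (fun i => c 0 i).
- by exists (fun i => c 0 i).
- by exists (\row_i c i) => //; apply: eq_bigr => i _; rewrite mxE.
Qed.

Lemma findim_basis (X : normedModType R) (E : set X) : findim_subspace E ->
  exists n (b : 'I_n -> X), E = range (rcomb b) /\ forall a, rcomb b a = 0 -> a = 0.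
Proof.
move=> /findim_subspaceP[n [b]]; elim: n b => [|n IH] b Eb.
  by exists 0%N, b; split=> // a _; apply/rowP => -[].
have [fb|] := pselect (forall a, rcomb b a = 0 -> a = 0); first by exists n.+1, b.
move=> /existsNP[a /not_implyP[ba /eqP/rV0Pn[j aj]]].
apply: (IH (fun i => b (lift j i))); rewrite Eb.
apply/seteqP; split=> _ [u _ <-].
  (* Subtracting this multiple of the relation [a] cancels coordinate [j] without changing the
     vector. *)
  exists (\row_i (u - (u 0 j / a 0 j) *: a) 0 (lift j i)) => //.
  have -> : rcomb b u = rcomb b (u - (u 0 j / a 0 j) *: a).
    by rewrite linearB linearZ /= ba scaler0 subr0.
  rewrite [RHS](bigD1_ord j) //= !mxE divfK // subrr scale0r add0r.
  by apply: eq_bigr => i _; rewrite mxE.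
exists (\row_i if unlift j i is Some k then u 0 k else 0) => //.
rewrite [LHS](bigD1_ord j) //= mxE unlift_none scale0r add0r.
by apply: eq_bigr => i _; rewrite mxE liftK.
Qed.

End Coordinates.

(** * From the closure to finite representability *)

Section ClosureFinitelyRepresentable.
Variable R : realType.
Implicit Types (mu nu : calP R) (F : set (calP R)).

Lemma c00_ext_rcomb_le mu n (p : 'I_n -> {poly R}) a :
  c00_ext mu (rcomb p a) <= `|a| * \sum_(i < n) c00_ext mu (p i).
Proof.
rewrite -norm_c00_in_X (linear_rcomb (@c00_in_X R mu)).
rewrite (le_trans (ler_norm_rcomb _ _)) // ler_wpM2l //.
by apply: ler_sum => i _; rewrite /= norm_c00_in_X.
Qed.

Lemma near_c00_ext_rcomb nu n (p : 'I_n -> {poly R}) (e : R) : 0 < e ->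
  \forall mu \near nu, forall a,
    `|c00_ext nu (rcomb p a) - c00_ext mu (rcomb p a)| <= e * `|a|.
Proof.
move=> e0; pose M := \sum_(i < n) (c00_ext nu (p i) + 1) + 1.
have ge0 mu q : 0 <= c00_ext mu q by rewrite -norm_c00_in_X.
have M0 : 0 < M by rewrite ltr_wpDl // sumr_ge0 // => i _; rewrite addr_ge0.
have e3 := divr_gt0 e0 (ltr0n R 3); have d0 := divr_gt0 e3 M0.
have ncov := (compact_near_coveringP _).1 (@compact_sphere R n).
have : \forall mu \near nu, [set a : 'rV[R]_n | `|a| = 1] `<=`
    (fun a => `|c00_ext nu (rcomb p a) - c00_ext mu (rcomb p a)| < e).
  apply: (ncov _ (nbhs nu) (fun mu a =>
    `|c00_ext nu (rcomb p a) - c00_ext mu (rcomb p a)| < e) _) => a _; near=> a' mu => /=.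
  have aa' : `|a - a'| < e / 3 / M by near: a'; exact: cvgr_dist_lt.
  have small la : (forall i, c00_ext la (p i) <= c00_ext nu (p i) + 1) ->
      `|c00_ext la (rcomb p a) - c00_ext la (rcomb p a')| < e / 3.
    move=> hla; rewrite (le_lt_trans (pseudonorm_dist (i := idfun) (c00_extP la) _ _)) //.
    rewrite -linearB (le_lt_trans (c00_ext_rcomb_le _ _ _)) //.
    apply: (@le_lt_trans _ _ (`|a - a'| * M)); last by rewrite -ltr_pdivlMr.
    by rewrite ler_wpM2l // (le_trans (ler_sum _ (fun i _ => hla i))) // lerDl.
  have h1 : `|c00_ext nu (rcomb p a) - c00_ext mu (rcomb p a)| < e / 3.
    by near: mu; exact: near_c00_ext.
  have /small h2 : forall i, c00_ext nu (p i) <= c00_ext nu (p i) + 1.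
    by move=> i; rewrite lerDl.
  have /small h3 : forall i, c00_ext mu (p i) <= c00_ext nu (p i) + 1.
    move=> i; have : `|c00_ext nu (p i) - c00_ext mu (p i)| < 1.
      by move: i; near: mu; apply: filter_forall => i; exact: near_c00_ext.
    by rewrite ltr_distlC => /andP[_ /ltW].
  move: h1 h2 h3; rewrite !ltr_norml => /andP[? ?] /andP[? ?] /andP[? ?].
  by apply/andP; split; lra.
apply: filterS => mu hmu a.
have [->|a0] := eqVneq a 0.
  by rewrite linear0 normr0 mulr0 -!norm_c00_in_X !linear0 !normr0 subrr normr0.
have a1 : 0 < `|a| by rewrite normr_gt0.
have /hmu/ltW : [set u : 'rV[R]_n | `|u| = 1] (`|a|^-1 *: a).
  by rewrite /= normrZ gtr0_norm ?invr_gt0 // mulVf ?gt_eqF.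
rewrite linearZ /= !(c00_extP _).2 /= -mulrBr normrM normr_id normfV normr_id.
by rewrite ler_pdivrMl // mulrC.
Unshelve. all: by end_near. Qed.

(** An isometric embedding [S] of [banach_of mu] suffices, since only finite-dimensional subspaces
    of [G j] are sought. *)
Lemma closure_finitely_representable F (K : Type) (J : set K)
    (G : K -> completeNormedModType R) nu :
  closure F nu ->
  (forall mu, F mu -> exists2 j, J j &
     exists S : {linear banach_of mu -> G j}, forall x, `|S x| = `|x|) ->
  finitely_representable (banach_of nu) J G.
Proof.
move=> Fnu FG E eps /findim_basis[n [b [EE fb]]] eps0; subst E.
have [c c0 hc] := basis_lower_bound fb.
(* Chosen so that [1 - d = (1 + eps)^-1] and [d <= eps]: a relative error [d] gives both bounds. *)
pose d := eps / (1 + eps); have d0 : 0 < d by rewrite divr_gt0 // addr_gt0.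
(* Half of the error [d * c] pays for replacing [nu] by [mu], half for replacing [b] by [p]. The
   latter is shared by [n] vectors, with [n.+1] avoiding a zero denominator. *)
have dc2 : 0 < d * c / 2 by rewrite divr_gt0 // mulr_gt0.
have dcn : 0 < d * c / 2 / n.+1%:R by rewrite divr_gt0.
have /choice[p hp] : forall i, exists p, `|b i - c00_in_X nu p| < d * c / 2 / n.+1%:R.
  by move=> i; apply: (dense_rangeP _).1 => //; exact: dense_c00_in_X.
have [mu [Fmu hmu]] := Fnu _ (near_c00_ext_rcomb nu p dc2).
have [j Jj [S nS]] := FG _ Fmu.
pose B i : G j := S (c00_in_X mu (p i)).
(* Coordinates in the basis [b], with the irrelevant value 0 outside its span. *)
have /choice[coef hcoef] : forall x, exists a, range (rcomb b) x -> rcomb b a = x.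
  move=> x; have [[a _ <-]|nx] := pselect (range (rcomb b) x); first by exists a.
  by exists 0 => /nx.
have coefK a : coef (rcomb b a) = a.
  by apply/eqP; rewrite -subr_eq0; apply/eqP/fb; rewrite linearB /= hcoef ?subrr.
exists j => //; exists (range (rcomb B)); first by apply/findim_subspaceP; exists n, B.
exists (rcomb B \o coef); split.
- move=> a _ _ [u _ <-] [v _ <-] /=.
  by rewrite -linearP !coefK linearP.
- move=> _ [a _ <-] /=; rewrite coefK.
  have nB : `|rcomb B a| = c00_ext mu (rcomb p a).
    rewrite -norm_c00_in_X -nS (linear_rcomb (@c00_in_X R mu)).
    by rewrite (linear_rcomb S).
  have dist_rcomb : `| `|rcomb b a| - `|rcomb B a| | <= d * `|rcomb b a|.
    rewrite (@le_trans _ _ (d * (c * `|a|))) ?ler_wpM2l ?(ltW d0) // nB.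
    have h1 := hmu a.
    have h2 : `|rcomb b a - c00_in_X nu (rcomb p a)| <= d * c / 2 * `|a|.
      rewrite (linear_rcomb (@c00_in_X R nu)).
      have -> : rcomb b a - rcomb (c00_in_X nu \o p) a =
          rcomb (fun i => b i - c00_in_X nu (p i)) a.
        by rewrite /rcomb -sumrB; apply: eq_bigr => i _; rewrite scalerBr.
      rewrite (le_trans (ler_norm_rcomb _ _)) // mulrC ler_wpM2r //.
      rewrite (le_trans (ler_sum _ (fun i _ => ltW (hp i)))) //.
      rewrite sumr_const card_ord -[leLHS]mulr_natr [leLHS]mulrAC ler_pdivrMr //.
      by rewrite ler_wpM2l ?(ltW dc2) // ler_nat.
    have h3 := ler_dist_dist (rcomb b a) (c00_in_X nu (rcomb p a)).
    rewrite norm_c00_in_X in h3.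
    rewrite -(subrKA (c00_ext nu (rcomb p a))) (le_trans (ler_normD _ _)) //.
    by rewrite mulrA [d * c]splitr mulrDl lerD // (le_trans h3).
  have t0 := normr_ge0 (rcomb b a).
  have dE : (1 + eps)^-1 = 1 - d.
    by rewrite /d -[X in X - _](divff (lt0r_neq0 (addr_gt0 ltr01 eps0))) -mulrBl addrK div1r.
  have de : d * `|rcomb b a| <= eps * `|rcomb b a|.
    by rewrite ler_wpM2r // ler_pdivrMr ?addr_gt0 // ler_peMr ?(ltW eps0) // lerDl ltW.
  move: dist_rcomb; rewrite dE ler_norml => /andP[? ?].
  by rewrite mulrBl mulrDl !mul1r; apply/andP; split; lra.
- by apply/seteqP; split=> [_ [_ [a _ <-] <-]|_ [a _ <-]] /=;
    [exists (coef (rcomb b a)) | exists (rcomb b a); rewrite ?coefK //; exists a].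
Qed.

End ClosureFinitelyRepresentable.

(** * Separable spaces and the characterization of closures *)

Lemma separable_dense_seq (R : realType) (X : normedModType R) : separable X ->
  exists d : nat -> X, dense (range (lincomb d)).
Proof.
(* The sequence inverts the injection [f] on [D], with value 0 at integers that are not codes. *)
move=> [D /countable_injP[f injf] dD]; exists (fun n => xget 0 [set x | D x /\ f x = n]).
move=> O O0 oO; have [x [Ox Dx]] := dD O O0 oO; exists x; split=> //.
exists 'X^(f x) => //; rewrite lincombXn.
have [Dy fyx] : [set y | D y /\ f y = f x] (xget 0 [set y | D y /\ f y = f x]).
  by apply: (xgetPex 0); exists x.
by apply: injf; rewrite ?inE.
Qed.

Theorem proposition1p9 (R : realType) :
  (forall I F : set (calP R),
     [\/ I = calB R, I = calPinf R | I = [set: calP R]] ->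
     F `<=` I ->
     (forall mu, F mu -> [set nu | I nu /\ isometric (banach_of nu) (banach_of mu)] `<=` F) ->
     [set nu | I nu /\ finitely_representable_in (banach_of nu) F] =
     closure F `&` I)
  /\
  (forall X : completeNormedModType R,
     separable X -> infinite_dimensional X ->
     forall I : set (calP R),
     [\/ I = calB R, I = calPinf R | I = [set: calP R]] ->
     [set nu | I nu /\ finitely_representable_in_space (banach_of nu) X] =
     closure [set mu | I mu /\ isometric (banach_of mu) X] `&` I).
Proof.
split=> [I F hI FI Fiso|X sX iX I hI].
  apply/seteqP; split=> nu [].
    move=> Inu nuF; split=> //.
    have dF mu : F mu -> exists d : nat -> banach_of mu, dense (range (lincomb d)).
      by exists (fun k => c00_in_X mu 'X^k); exact: dense_lincomb_banach_of.
    have iF : I `<=` calPinf R -> forall mu, F mu -> infinite_dimensional (banach_of mu).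
      by move=> IP mu Fmu; exact/IP/FI.
    (* Closure of [F] under isometry within [I] puts the approximating pseudonorms in [F] itself. *)
    apply: closureS (finitely_representable_closure hI Inu iF dF nuF).
    by move=> la [Ila [mu Fmu iso]]; exact: (Fiso mu).
  move=> nuF Inu; split=> //; apply: (closure_finitely_representable nuF) => mu Fmu.
  by exists mu => //; exists idfun.
apply/seteqP; split=> nu [].
  move=> Inu nuX; split=> //.
  have dX := separable_dense_seq sX.
  apply: closureS (finitely_representable_closure hI Inu _ (fun _ _ => dX) nuX) => //.
  by move=> mu [Imu [_ _ iso]].
move=> nuX Inu; split=> //; apply: (closure_finitely_representable nuX) => mu.
by move=> [_ [T [_ nT]]]; exists tt => //; exists T.
Qed.
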